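(* Let $n$ be a positive even integer, let $k\geq 1$ and $r\geq 0$ be integers, and let $\pi=(d_1,\ldots,d_n)$ be a non-increasing graphic sequence such that $\mathcal{D}_k(\pi)=(d_1-k,\ldots,d_n-k)$ is graphic. If $k\geq \frac{d_1}{2}+r$ or $k\geq n-1-d_n+2r$, then $\pi$ has a realization with a $k$-factor that has at least $r+1$ edge-disjoint $1$-factors.
   Context: All graphs are finite and simple. A sequence $(d_1,\ldots,d_n)$ of non-negative integers is graphic (a degree sequence) if there is a simple graph $G$ with vertex set $\{v_1,\ldots,v_n\}$ such that $\deg_G(v_i)=d_i$ for all $i$; such a $G$ is called a realization of the sequence. A $k$-factor of a graph is a spanning subgraph in which every vertex has degree $k$; a $1$-factor is a perfect matching. The $1$-factors in the conclusion are $1$-factors of the $k$-factor, i.e. they are contained in it. *)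

(* Defs.v *)
From HB Require Import structures.
From mathcomp Require Import all_boot all_order all_algebra.

Set Implicit Arguments.
Unset Strict Implicit.
Unset Printing Implicit Defensive.

Import Order.TTheory GRing.Theory Num.Theory.

Local Open Scope ring_scope.

Record sgraph (T : finType) := SGraph {
  adj :> rel T;
  adj_sym : symmetric adj;
  adj_irr : irreflexive adj
}.

Definition deg (T : finType) (G : sgraph T) (v : T) : nat :=
  #|[set w | G v w]|.

(* Degree sequences are integer-valued, so that subtracting k from the entries
   is not truncated; a sequence with a negative entry has no realization. *)
Definition realization (n : nat) (d : n.-tuple int) (G : sgraph 'I_n) : Prop :=
  forall i : 'I_n, (deg G i)%:Z = tnth d i.

Definition graphic (n : nat) (d : n.-tuple int) : Prop :=
  exists G : sgraph 'I_n, realization d G.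

Definition D_ (k : nat) (n : nat) (d : n.-tuple int) : n.-tuple int :=
  [tuple tnth d i - k%:Z | i < n].

Definition factor (k : nat) (T : finType) (G F : sgraph T) : Prop :=
  subrel F G /\ forall v : T, deg F v = k.

Definition edge_disjoint (T : finType) (F1 F2 : sgraph T) : Prop :=
  forall v w : T, ~~ (F1 v w && F2 v w).

Definition has_edge_disjoint_1factors (T : finType) (m : nat) (G : sgraph T)
    : Prop :=
  exists M : 'I_m -> sgraph T,
    (forall i, factor 1 G (M i)) /\
    (forall i j, i != j -> edge_disjoint (M i) (M j)).

(* Main.v *)
Require Import Defs.
From HB Require Import structures.
From mathcomp Require Import all_boot all_order all_algebra perm.
From mathcomp Require Import zify lra.

Set Implicit Arguments.
Unset Strict Implicit.
Unset Printing Implicit Defensive.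

Import Order.TTheory GRing.Theory Num.Theory.

(** Let A be a realization of [D_ k d] and B the complement of a realization of d.
    At every vertex their degrees add up to n - 1 - k, and what is sought is a
    decomposition of the complete graph into A, B and a k-regular graph H, with
    the degrees of A and B as given: then A together with H realizes d.
    Kundu's theorem ([kundu_packing]) provides one. The two alternatives of the
    hypothesis say that A, respectively B, has all its degrees at most k - 2r.
    Let C be that graph; it is kept fixed, and edges are only exchanged between H
    and the third graph, the complement of both.

    The main point is that, on an even number of vertices and for k > 0, a k-regular
    graph H disjoint from a graph C of maximum degree at most k can be replaced
    by one, still disjoint from C, that has a 1-factor ([regular_1factor]). Suppose that H has none. Gallai-Edmonds theory and
    a count of edges give two components Q1 and Q2 of H minus a set of
    vertices, each with fewer than k boundary edges, such that for all x1 in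
    Q1 and y1 in Q2 some maximum matching of H misses both ([light_components]).
    Having so few boundary edges, Q1 and Q2 have more than k vertices each, which
    is too many for C to join everything: there are edges x1 x2 in Q1 and
    y1 y2 in Q2 such that neither x1 y1 nor x2 y2 is in C ([exists_exchange]).
    Trading the former pair of edges for the latter keeps H regular and disjoint
    from C and lets a maximum matching that misses x1 and y1 be extended by the
    edge x1 y1 ([reduce_defect]). Repeating this ends with a 1-factor.

    Finally each 1-factor found is moved from H to C ([regular_1factors]). After j
    steps H is (k - j)-regular and C has degrees at most k - 2r + j, so
    the step can be performed for j = 0, ..., r. *)

(** * Graph operations and edge exchanges *)

Lemma adjC (V : finType) (G : sgraph V) x y : G x y = G y x.
Proof. exact: adj_sym. Qed.

Lemma adjxx (V : finType) (G : sgraph V) x : G x x = false.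
Proof. exact: adj_irr. Qed.

Lemma adj_neq (V : finType) (G : sgraph V) x y : G x y -> x != y.
Proof. by apply: contraTneq => ->; rewrite adjxx. Qed.

Program Definition unionG (V : finType) (G F : sgraph V) : sgraph V :=
  @SGraph V [rel x y | G x y || F x y] _ _.
Next Obligation. by move=> x y /=; rewrite adjC (adjC F). Qed.
Next Obligation. by move=> x /=; rewrite !adjxx. Qed.

Program Definition interG (V : finType) (G F : sgraph V) : sgraph V :=
  @SGraph V [rel x y | G x y && F x y] _ _.
Next Obligation. by move=> x y /=; rewrite adjC (adjC F). Qed.
Next Obligation. by move=> x /=; rewrite !adjxx. Qed.

Program Definition diffG (V : finType) (G F : sgraph V) : sgraph V :=
  @SGraph V [rel x y | G x y && ~~ F x y] _ _.
Next Obligation. by move=> x y /=; rewrite adjC (adjC F). Qed.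
Next Obligation. by move=> x /=; rewrite !adjxx. Qed.

Program Definition complG (V : finType) (G : sgraph V) : sgraph V :=
  @SGraph V [rel x y | (x != y) && ~~ G x y] _ _.
Next Obligation. by move=> x y /=; rewrite eq_sym adjC. Qed.
Next Obligation. by move=> x /=; rewrite eqxx. Qed.

Program Definition edgeG (V : finType) (a b : V) : sgraph V :=
  @SGraph V [rel x y | (x != y) && ([set x; y] == [set a; b])] _ _.
Next Obligation. by move=> x y /=; rewrite eq_sym setUC. Qed.
Next Obligation. by move=> x /=; rewrite eqxx. Qed.

Lemma edgeGE (V : finType) (a b x y : V) : a != b ->
  edgeG a b x y = ((x == a) && (y == b)) || ((x == b) && (y == a)).
Proof.
move=> ab /=; apply/idP/idP.
  case/andP=> xy /eqP E.
  have: x \in [set a; b] by rewrite -E set21.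
  have: y \in [set a; b] by rewrite -E set22.
  rewrite !inE => /orP[]/eqP ya /orP[]/eqP xa; subst x y;
    by rewrite ?eqxx ?orbT // eqxx in xy *.
case/orP=> /andP[/eqP-> /eqP->]; first by rewrite ab eqxx.
by rewrite eq_sym ab setUC eqxx.
Qed.

Lemma deg_unionI (V : finType) (G F : sgraph V) v :
  deg (unionG G F) v + deg (interG G F) v = deg G v + deg F v.
Proof.
rewrite /deg -[RHS]cardsUI; congr (_ + _); by apply: eq_card => w; rewrite !inE.
Qed.

Lemma deg_union (V : finType) (G F : sgraph V) v :
  edge_disjoint G F -> deg (unionG G F) v = deg G v + deg F v.
Proof.
move=> GF; rewrite -deg_unionI [X in _ + X](_ : _ = 0) ?addn0 //.
by apply/eqP; rewrite cards_eq0; apply/eqP/setP => w; rewrite !inE /= (negPf (GF _ _)).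
Qed.

Lemma deg_diff (V : finType) (G F : sgraph V) v :
  subrel F G -> deg (diffG G F) v + deg F v = deg G v.
Proof.
move=> FG; rewrite -deg_union /=; last by move=> x y /=; case: (F x y); rewrite ?andbF.
apply: eq_card => w; rewrite !inE /=; case E: (F v w); rewrite ?orbT ?orbF ?andbT //.
by rewrite FG.
Qed.

Lemma deg_compl (V : finType) (G : sgraph V) v : deg (complG G) v + deg G v + 1 = #|V|.
Proof.
rewrite -cardsT (cardsD1 v) inE add1n addn1 /deg -cardsUI.
rewrite [X in _ + X](_ : _ = 0) ?addn0; last first.
  by apply/eqP; rewrite cards_eq0; apply/eqP/setP => w; rewrite !inE /= -andbA andNb andbF.
congr _.+1; apply: eq_card => w; rewrite !inE /= andbT eq_sym.
by case: eqVneq => [->|_] /=; rewrite ?adjxx ?orNb.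
Qed.

Lemma deg_edge (V : finType) (a b v : V) : a != b ->
  deg (edgeG a b) v = (v == a) + (v == b).
Proof.
move=> ab; rewrite /deg.
have -> : [set w | edgeG a b v w] =
    [set w | ((v == a) && (w == b)) || ((v == b) && (w == a))].
  by apply/setP => w; rewrite !inE edgeGE.
have [-> | va] := eqVneq v a.
  rewrite (negPf ab) (_ : [set w | _] = [set b]) ?cards1 //.
  by apply/setP => w; rewrite !inE orbF.
have [vb | vb] := eqVneq v b.
  by rewrite (_ : [set w | _] = [set a]) ?cards1 //; apply/setP => w; rewrite !inE.
by apply/eqP; rewrite cards_eq0; apply/eqP/setP => w; rewrite !inE.
Qed.

(** The exchange that trades the edges ab and cd for ac and bd; both parts of
    the proof improve a graph by such exchanges. *)
Definition swapG (V : finType) (G : sgraph V) (a b c d : V) : sgraph V :=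
  unionG (diffG G (unionG (edgeG a b) (edgeG c d)))
         (unionG (edgeG a c) (edgeG b d)).

Lemma edge_sub (V : finType) (G : sgraph V) a b : G a b -> subrel (edgeG a b) G.
Proof.
move=> Gab x y; rewrite edgeGE ?(adj_neq Gab) //.
by case/orP=> /andP[/eqP-> /eqP->] //; rewrite adjC.
Qed.

(** The hypotheses force a, b, c and d to be distinct, so each of the four
    vertices loses one edge and gains one. *)
Lemma deg_swap (V : finType) (G : sgraph V) a b c d v :
  G a b -> G c d -> ~~ G a c -> ~~ G b d -> a != c -> b != d ->
  deg (swapG G a b c d) v = deg G v.
Proof.
move=> Gab Gcd Gac Gbd ac bd.
have ab := adj_neq Gab; have cd := adj_neq Gcd.
have ad : a != d by apply: contraNneq Gac => ->; rewrite adjC.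
have bc : b != c by apply: contraNneq Gbd => ->.
have dj p q s t : p != q -> s != t -> p != s -> p != t ->
    edge_disjoint (edgeG p q) (edgeG s t).
  move=> pq st ps pt x y; rewrite !edgeGE //; apply/negP.
  by case/andP=> /orP[]/andP[/eqP-> /eqP->];
     rewrite ?(negPf ps) ?(negPf pt) ?andbF.
have new : subrel (unionG (edgeG a c) (edgeG b d)) (complG G).
  by move=> x y /orP[]; apply: edge_sub; rewrite /= ?ac ?bd.
rewrite deg_union; last first.
  move=> x y; apply/negP => /andP[/andP[Gxy _]] /new.
  by rewrite /= Gxy andbF.
have sub : subrel (unionG (edgeG a b) (edgeG c d)) G.
  by move=> x y /orP[]; apply: edge_sub.
rewrite -(deg_diff v sub) !deg_union ?deg_edge //; last by apply: dj.
- by rewrite -!addnA; congr (_ + _); rewrite addnCA (addnCA (v == b)) addnCA; lia.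
- by apply: dj; rewrite // eq_sym.
Qed.

(** * Packing two graphs *)

(** Kundu's theorem, as a packing statement: the complement of the union of A'
    and B' is then a k-regular graph. Take A and B with the fewest common
    edges, suppose that there is one, and choose a vertex v that meets the most
    common edges, say q, and a common edge uv. Call a pair white if it lies in
    neither graph: a vertex that meets p common edges has k + p white
    neighbours. Let x be a white neighbour of u. If some white neighbour y <> x
    of v has xy not white, then uv and xy lie in the same graph, and trading
    them for ux and vy there removes the common edge uv and creates none.
    Otherwise the white neighbours of x include u, all white neighbours of v
    other than x, and v itself if x is one of them: at least k + q + 1, so x
    meets more than q common edges. *)
Lemma kundu_packing (V : finType) (k : nat) (A B : sgraph V) :
  (forall v, deg A v + deg B v + k + 1 = #|V|) ->
  exists A' B' : sgraph V,
    [/\ forall v, deg A' v = deg A v, forall v, deg B' v = deg B v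
      & edge_disjoint A' B'].
Proof.
have [m] := ubnP #|[set e : V * V | A e.1 e.2 && B e.1 e.2]|.
elim: m => // m IH in A B *; rewrite ltnS => le_m hdeg.
pose I := interG A B.
pose W := complG (unionG A B).
have degW v : deg W v = k + deg I v.
  by have := deg_compl (unionG A B) v; have := deg_unionI A B v;
     have := hdeg v; rewrite -/W -/I; lia.
have [none|] := boolP [forall x, forall y, ~~ I x y].
  exists A, B; split=> // x y; exact: (forallP (forallP none x) y).
rewrite negb_forall => /existsP[x0]; rewrite negb_forall => /existsP[y0].
rewrite negbK => Ixy0.
have {x0 y0 Ixy0} [u [v [Iuv vmax]]] :
    exists u v, I u v /\ forall x, deg I x <= deg I v.
  case: (@arg_maxnP _ x0 xpredT (deg I)) => // v _ vmax.
  have : 0 < deg I v.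
    apply: leq_trans (vmax x0 isT); rewrite card_gt0.
    by apply/set0Pn; exists y0; rewrite inE.
  rewrite card_gt0 => /set0Pn[u]; rewrite inE => Ivu.
  by exists u, v; split=> [|x]; [rewrite (adjC I) | apply: vmax].
have [Auv Buv] := andP Iuv.
have [x] : exists x, W u x.
  have : 0 < deg W u.
    rewrite degW addn_gt0 orbC card_gt0.
    by apply/orP; left; apply/set0Pn; exists v; rewrite inE.
  by rewrite card_gt0 => /set0Pn[x]; rewrite inE; exists x.
move=> Wux.
have nWuv : ~~ W u v by rewrite /= Auv andbF.
(* otherwise x would have more white neighbours, hence more common edges, than v *)
have [y Wvy [xy nWxy]] : exists2 y, W v y & x != y /\ ~~ W x y.
  have [/exists_inP[y Wvy /andP[xy nW]]|] :=
    boolP [exists (y | W v y), (x != y) && ~~ W x y]; first by exists y.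
  rewrite negb_exists_in => /forall_inP full.
  have : deg W v < deg W x.
    have [Wvx|nWvx] := boolP (W v x).
      rewrite /deg (cardsD1 x [set w | W v w]) inE Wvx add1n.
      have sub : [set u; v] :|: [set w | W v w] :\ x \subset [set w | W x w].
        apply/subsetP => w; rewrite !inE.
        case/orP=> [/orP[]/eqP->|/andP[wx Wvw]].
        - by rewrite (adjC W).
        - by rewrite (adjC W).
        - by move: (full w Wvw); rewrite eq_sym wx negbK.
      apply: leq_trans (subset_leq_card sub).
      rewrite cardsU cards2 (adj_neq Iuv).
      rewrite [X in _ - X](_ : _ = 0) ?subn0 ?add2n //.
      apply/eqP; rewrite cards_eq0; apply/eqP/setP => w; rewrite !inE.
      case: (eqVneq w u) => [->|_]; first by rewrite (adjC W) (negPf nWuv) !andbF.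
      by case: eqVneq => // ->; rewrite adjxx !andbF.
    have sub : u |: [set w | W v w] \subset [set w | W x w].
      apply/subsetP => w; rewrite !inE.
      case/orP=> [/eqP->|Wvw]; first by rewrite (adjC W).
      move: (full w Wvw); rewrite negb_and !negbK => /orP[/eqP xw|//].
      by rewrite xw Wvw in nWvx.
    apply: leq_trans (subset_leq_card sub).
    by rewrite cardsU1 inE (adjC W) nWuv.
  by rewrite !degW; have := vmax x; lia.
have [Aux Bux] : ~~ A u x /\ ~~ B u x.
  by move: Wux => /= /andP[_]; rewrite negb_or => /andP.
have [Avy Bvy] : ~~ A v y /\ ~~ B v y.
  by move: Wvy => /= /andP[_]; rewrite negb_or => /andP.
have less (A1 B1 : sgraph V) : subrel (interG A1 B1) I -> ~~ interG A1 B1 u v ->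
    #|[set e : V * V | A1 e.1 e.2 && B1 e.1 e.2]| < m.
  move=> sub nuv; apply: leq_trans le_m; apply: proper_card.
  apply/properP; split.
    by apply/subsetP => -[a b]; rewrite !inE; apply: sub.
  by exists (u, v); rewrite !inE.
(* stated for two arbitrary graphs: xy may lie in A or in B *)
have swapI (A1 B1 : sgraph V) : ~~ A1 u x -> ~~ A1 v y -> ~~ B1 u x -> ~~ B1 v y ->
    A1 u v -> A1 x y ->
  subrel (interG (swapG A1 u v x y) B1) (interG A1 B1)
    /\ ~~ interG (swapG A1 u v x y) B1 u v.
  move=> A1ux A1vy B1ux B1vy A1uv A1xy.
  have ux := adj_neq Wux; have vy := adj_neq Wvy; have uv := adj_neq Iuv.
  split=> [a b /= /andP[]|].
    case/orP=> [/andP[-> _]->//|/orP[]] E.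
      have := @edge_sub V (complG B1) u x _ a b E; rewrite /= ux B1ux => /(_ isT).
      by case/andP=> _ /negPf->.
    have := @edge_sub V (complG B1) v y _ a b E; rewrite /= vy B1vy => /(_ isT).
    by case/andP=> _ /negPf->.
  rewrite -[interG _ _ _ _]/((A1 u v && ~~ (edgeG u v u v || edgeG x y u v) ||
    (edgeG u x u v || edgeG v y u v)) && B1 u v).
  rewrite !edgeGE ?(adj_neq A1xy) // !eqxx /= andbF /=.
  have vx : v != x by apply: contraNneq nWuv => ->.
  have uy : u != y by apply: contraNneq nWuv => ->; rewrite (adjC W).
  by rewrite (negPf vx) (negPf uv) (negPf uy) (negPf ux).
have ux := adj_neq Wux; have vy := adj_neq Wvy.
move: nWxy; rewrite /= xy /= negbK => /orP[Axy|Bxy].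
  have [sub nuv] := swapI A B Aux Avy Bux Bvy Auv Axy.
  have degS w := deg_swap w Auv Axy Aux Avy ux vy.
  have [||A' [B' [dA dB dAB]]] := IH (swapG A u v x y) B.
  - exact: less.
  - by move=> w; rewrite degS.
  by exists A', B'; split=> // w; rewrite dA degS.
have [sub nuv] := swapI B A Bux Bvy Aux Avy Buv Bxy.
have degS w := deg_swap w Buv Bxy Bux Bvy ux vy.
have [||A' [B' [dA dB dAB]]] := IH A (swapG B u v x y).
- apply: less; last by rewrite /= andbC.
  by move=> a b /=; rewrite andbC => /sub /=; rewrite andbC.
- by move=> w; rewrite degS.
by exists A', B'; split=> // w; rewrite dB degS.
Qed.

(** * Maximum matchings *)

(** A matching is encoded as the involution that swaps the ends of its edges,
    so that its unmatched vertices are the fixed points; finite functions make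
    maximum matchings exist by finiteness. *)
Definition matching (V : finType) (G : sgraph V) (f : {ffun V -> V}) : bool :=
  [forall x, (f (f x) == x) && ((f x == x) || G x (f x))].

Definition unmatched (V : finType) (f : {ffun V -> V}) : {set V} :=
  [set x | f x == x].

Lemma matchingP (V : finType) (G : sgraph V) (f : {ffun V -> V}) :
  reflect (involutive f /\ forall x, f x != x -> G x (f x)) (matching G f).
Proof.
apply: (iffP forallP) => [h|[h1 h2] x].
  split=> x; first by have /andP[/eqP] := h x.
  by move=> nf; have /andP[_] := h x; rewrite (negPf nf).
by rewrite h1 eqxx /=; case: eqVneq => //= nf; apply: h2.
Qed.

(** The number of vertices left uncovered by a maximum matching: fewest fixed
    points means most edges. *)
Definition defect (V : finType) (G : sgraph V) : nat :=
  #|unmatched [arg min_(f < [ffun x => x] | matching G f) #|unmatched f|]|.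

Definition maximum (V : finType) (G : sgraph V) (f : {ffun V -> V}) : bool :=
  matching G f && (#|unmatched f| == defect G).

Definition missable (V : finType) (G : sgraph V) (x : V) : Prop :=
  exists2 f, maximum G f & f x = x.

Definition comissable (V : finType) (G : sgraph V) (x y : V) : Prop :=
  exists2 f, maximum G f & f x = x /\ f y = y.

Lemma matching_id (V : finType) (G : sgraph V) : matching G [ffun x => x].
Proof. by apply/forallP => x; rewrite !ffunE eqxx. Qed.

Lemma defect_le (V : finType) (G : sgraph V) f : matching G f -> defect G <= #|unmatched f|.
Proof.
by rewrite /defect; case: arg_minnP => [|g _ gmin /gmin //]; apply: matching_id.
Qed.

Lemma exists_maximum (V : finType) (G : sgraph V) : exists f, maximum G f.
Proof.
rewrite /maximum /defect; case: arg_minnP => [|g g_match _]; first exact: matching_id.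
by exists g; rewrite g_match /=.
Qed.

Lemma maximum_matching (V : finType) (G : sgraph V) f : maximum G f -> matching G f.
Proof. by case/andP. Qed.

Lemma card_maximum (V : finType) (G : sgraph V) f :
  maximum G f -> #|unmatched f| = defect G.
Proof. by case/andP => _ /eqP. Qed.

Lemma maximumE (V : finType) (G : sgraph V) f :
  matching G f -> #|unmatched f| <= defect G -> maximum G f.
Proof. by move=> fM le; rewrite /maximum fM eqn_leq le defect_le. Qed.

(** The points of Q that f moves are paired off by f. *)
Lemma odd_fixpoints (V : finType) (f : V -> V) (Q : {set V}) :
  involutive f -> {in Q, forall x, f x \in Q} ->
  odd #|[set x in Q | f x == x]| = odd #|Q|.
Proof.
move=> fI fQ.
pose lo := [set x in Q | enum_rank x < enum_rank (f x)].
pose hi := [set x in Q | enum_rank (f x) < enum_rank x].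
have hiE : hi = f @: lo.
  apply/setP => x; apply/idP/imsetP => [|[y]].
    by rewrite inE => /andP[xQ xf]; exists (f x); rewrite ?inE ?fI ?fQ.
  by rewrite !inE => /andP[yQ yf] ->; rewrite fI fQ.
have card_hi : #|hi| = #|lo| by rewrite hiE card_imset //; apply: inv_inj.
have -> : #|Q| = #|[set x in Q | f x == x]| + (#|lo| + #|hi|).
  rewrite -(cardsID [set x | f x == x]) [X in _ + X](_ : _ = #|lo :|: hi|).
    congr (_ + _); first by apply: eq_card => x; rewrite !inE.
    rewrite -cardsUI [X in _ + X](_ : _ = 0) ?addn0 //.
    by apply/eqP; rewrite cards_eq0; apply/eqP/setP => x; rewrite !inE; lia.
  apply: eq_card => x; rewrite !inE.
  rewrite -(inj_eq enum_rank_inj) -(inj_eq val_inj) /= andbC -andb_orr neq_ltn.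
  by rewrite orbC.
by rewrite card_hi addnn oddD odd_double addbF.
Qed.

Lemma matching_add (V : finType) (G : sgraph V) (f : {ffun V -> V}) a b :
  matching G f -> f a = a -> f b = b -> G a b ->
  exists2 g, matching G g & #|unmatched g| < #|unmatched f|.
Proof.
move=> /matchingP[fI fG] fa fb Gab; have ab := adj_neq Gab.
have fE x z : f z = z -> (f x == z) = (x == z).
  by move=> fz; rewrite -{1}fz (inj_eq (inv_inj fI)).
pose g := [ffun x => if x == a then b else if x == b then a else f x].
exists g.
  apply/matchingP; split=> x; rewrite !ffunE.
    case: (eqVneq x a) => [->|xa]; first by rewrite eq_sym (negPf ab) eqxx.
    case: (eqVneq x b) => [->|xb]; first by rewrite eqxx.
    by rewrite !fE // (negPf xa) (negPf xb) fI.
  case: (eqVneq x a) => [->|xa] //.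
  case: (eqVneq x b) => [->|xb]; first by rewrite adjC.
  exact: fG.
apply: proper_card; apply/properP; split; last first.
  by exists a; rewrite !inE ?fa // ffunE !eqxx eq_sym.
apply/subsetP => x; rewrite !inE ffunE.
case: (eqVneq x a) => [->|xa]; first by rewrite fa eqxx.
by case: (eqVneq x b) => [->|xb //]; rewrite fb eqxx.
Qed.

Lemma adj_not_comissable (V : finType) (G : sgraph V) x y :
  G x y -> ~ comissable G x y.
Proof.
move=> Gxy [f fmax [fx fy]].
have [g gM] := matching_add (maximum_matching fmax) fx fy Gxy.
by rewrite (card_maximum fmax) ltnNge defect_le.
Qed.

(** The heart of Gallai's lemma. Let f be a maximum matching that misses t, g one
    that misses x and y, and let f agree with g as much as possible. Since f
    and g have equally many unmatched vertices, and x and y are unmatched in g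
    only, f misses a vertex z other than t that g covers. The partner w of z in
    g is covered by f, and rematching w from its partner in f to z yields a
    maximum matching that still misses t and agrees better with g. *)
Lemma not_comissable_trans (V : finType) (G : sgraph V) x t y :
  missable G t -> ~ comissable G x t -> ~ comissable G t y -> x != y ->
  ~ comissable G x y.
Proof.
case=> f fmax ft nxt nty xy [g gmax [gx gy]].
have [m] := ubnP (#|V| - #|[set v | f v == g v]|).
elim: m => // m IH in f fmax ft *; rewrite ltnS => le_m.
have [fI fG] := matchingP _ _ (maximum_matching fmax).
have [gI gG] := matchingP _ _ (maximum_matching gmax).
have gt : g t != t by apply/eqP => gt; apply: nxt; exists g.
have fx : f x != x by apply/eqP => fx; apply: nxt; exists f.
have fy : f y != y by apply/eqP => fy; apply: nty; exists f.
have [z zt [fz gz]] : exists2 z, z != t & f z = z /\ g z != z.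
  have : 0 < #|(unmatched f :\: unmatched g) :\ t|.
    have : 1 < #|unmatched g :\: unmatched f|.
      have sub : [set x; y] \subset unmatched g :\: unmatched f.
        by apply/subsetP => w; rewrite !inE => /orP[]/eqP->;
           rewrite ?gx ?gy ?eqxx ?andbT.
      by apply: leq_trans (subset_leq_card sub); rewrite cards2 xy.
    have := cardsD1 t (unmatched f :\: unmatched g).
    have := cardsID (unmatched g) (unmatched f).
    have := cardsID (unmatched f) (unmatched g).
    rewrite (setIC (unmatched g)) (card_maximum fmax) (card_maximum gmax) => <-.
    by case: (t \in _); lia.
  rewrite card_gt0 => /set0Pn[z]; rewrite !inE => /and3P[zt gz /eqP fz].
  by exists z.
pose w := g z; have wz : w != z by [].
have gw : g w = z by rewrite /w gI.
have fw : f w != w.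
  apply/eqP => fw; have [|h hM] := matching_add (maximum_matching fmax) fz fw.
    exact: gG.
  by rewrite (card_maximum fmax) ltnNge defect_le.
pose p := f w; have fp : f p = w by rewrite /p fI.
have pz : p != z by apply: contraNneq wz => pz; rewrite -fp pz fz.
have pw : p != w by [].
have tz : t != z by rewrite eq_sym.
have tw : t != w by apply: contraNneq fw => <-; rewrite ft.
have tp : t != p by apply: contraNneq tw => tp; rewrite -fp -tp ft.
have fE v : v != z -> v != w -> v != p -> [/\ f v != z, f v != w & f v != p].
  move=> vz vw vp; split.
  - by apply: contraNneq vz => E; rewrite -(fI v) E fz.
  - by apply: contraNneq vp => E; rewrite -(fI v) E.
  - by apply: contraNneq vw => E; rewrite -(fI v) E fp.
(* conjugating by a transposition keeps an involution and its number of fixed points *)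
pose h := [ffun v => tperm z p (f (tperm z p v))].
have zw : z != w by rewrite eq_sym.
have hz : h z = w by rewrite ffunE tpermL fp tpermD.
have hw : h w = z by rewrite ffunE (tpermD zw pw) tpermR.
have hp : h p = p by rewrite ffunE tpermR fz tpermL.
have hE v : v != z -> v != w -> v != p -> h v = f v.
  move=> vz vw vp; have [? _ ?] := fE v vz vw vp.
  by rewrite ffunE !tpermD // eq_sym.
have hmax : maximum G h.
  apply: maximumE.
    apply/matchingP; split=> v; first by rewrite !ffunE tpermK fI tpermK.
    have [->|vz] := eqVneq v z; first by rewrite hz => _; apply: gG.
    have [->|vw] := eqVneq v w; first by rewrite hw adjC => _; apply: gG.
    have [->|vp] := eqVneq v p; first by rewrite hp eqxx.
    by rewrite hE // => /fG.
  rewrite -(card_maximum fmax) -[leqRHS](card_imset _ (@perm_inj _ (tperm z p))).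
  apply/subset_leq_card/subsetP => v; rewrite inE ffunE => /eqP E.
  apply/imsetP; exists (tperm z p v); last by rewrite tpermK.
  by rewrite inE -{2}E tpermK.
apply: (IH h) => //; first by rewrite hE.
apply: leq_trans le_m; apply: ltn_sub2l.
  rewrite -[X in _ < X]cardsT; apply: proper_card.
  rewrite properT; apply/eqP => /setP/(_ z); rewrite !inE fz => /eqP E.
  by rewrite -E eqxx in gz.
apply: proper_card; apply/properP; split; last first.
  by exists z; rewrite inE ?hz // fz eq_sym.
apply/subsetP => v; rewrite !inE.
have [->|vz] := eqVneq v z; first by rewrite hz.
have [->|vw] := eqVneq v w; first by rewrite hw gw.
have [->|vp] := eqVneq v p.
  rewrite fp => /eqP E; have : p = z by rewrite -(gI p) -E gw.
  by move/eqP; rewrite (negPf pz).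
by rewrite hE.
Qed.

(** Gallai's lemma: by the previous lemma, being equal or not simultaneously
    missable is transitive, and it holds along the edges of a path. *)
Lemma gallai (V : finType) (G : sgraph V) x y :
  (forall v, missable G v) -> connect G x y -> x = y \/ ~ comissable G x y.
Proof.
move=> miss /connectP[p]; elim: p x => [|x' p IH] x /=; first by left.
case/andP=> Gxx' path_p last_y.
have nx' := adj_not_comissable Gxx'.
have [<-|nx'y] := IH x' path_p last_y; first by right.
have [->|xy] := eqVneq x y; first by left.
by right; apply: not_comissable_trans nx' nx'y xy.
Qed.

Lemma connect_matching (V : finType) (G : sgraph V) f x :
  matching G f -> connect G x (f x).
Proof.
case/matchingP=> fI fG; have [->|/fG] := eqVneq (f x) x; first exact: connect0.
exact: connect1.
Qed.

Lemma connectC (V : finType) (G : sgraph V) x y : connect G x y = connect G y x.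
Proof. by apply: sym_connect_sym; apply: adj_sym. Qed.

(** With [gallai], a maximum matching misses exactly one vertex of each component
    when every vertex is missable. There is at least one because the component
    is odd: a maximum matching that misses x misses nothing else in it. *)
Lemma component_unmatched (V : finType) (G : sgraph V) f x :
  (forall v, missable G v) -> maximum G f ->
  exists2 q, connect G x q & f q = q.
Proof.
move=> miss fmax.
pose Q := [set y | connect G x y].
have QM h : matching G h -> {in Q, forall y, h y \in Q}.
  move=> hM y; rewrite !inE => xy.
  exact: connect_trans xy (connect_matching y hM).
have [g gmax gx] := miss x.
have [fM gM] := (maximum_matching fmax, maximum_matching gmax).
have [[fI _] [gI _]] := (matchingP _ _ fM, matchingP _ _ gM).
have : odd #|[set y in Q | f y == y]|.
  rewrite (odd_fixpoints fI (QM f fM)) -(odd_fixpoints gI (QM g gM)).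
  rewrite (_ : [set y in Q | g y == y] = [set x]) ?cards1 //.
  apply/setP => y; rewrite !inE; apply/andP/eqP => [[xy /eqP gy]|->].
    have [//|[]] := gallai miss xy; by exists g.
  by rewrite gx.
case: (set_0Vmem [set y in Q | f y == y]) => [->|[q]]; first by rewrite cards0.
by rewrite !inE => /andP[xq /eqP fq] _; exists q.
Qed.

(** * Hall's marriage theorem *)

(** Rado's proof: as long as some N i has two elements a and b, one of them can be
    deleted from N i. If both deletions broke the hypothesis, at sets X and Y,
    then X :|: Y or X :&: Y without i would violate it for N, by
    submodularity of the size of a union. *)
Lemma hall (I K : finType) (A : {set I}) (N : I -> {set K}) (k0 : K) :
  (forall X : {set I}, X \subset A -> #|X| <= #|\bigcup_(i in X) N i|) ->
  exists2 s : I -> K, {in A &, injective s} & forall i, i \in A -> s i \in N i.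
Proof.
have [m] := ubnP (\sum_(i in A) #|N i|).
elim: m => // m IH in N *; rewrite ltnS => le_m hallN.
have [thin|] := boolP [forall i in A, #|N i| <= 1].
  pose s i := odflt k0 [pick x in N i].
  have sN i : i \in A -> N i = [set s i].
    move=> iA; apply/eqP; rewrite eq_sym eqEcard sub1set cards1 andbC.
    rewrite (forall_inP thin i iA) /= /s; case: pickP => //= N0.
    have := hallN [set i]; rewrite sub1set iA cards1 big_set1 => /(_ isT).
    by rewrite card_gt0 => /set0Pn[x]; rewrite N0.
  exists s => [i j iA jA sij | i iA]; last by rewrite sN ?set11.
  apply/eqP; apply: contraT => ij.
  have := hallN [set i; j]; rewrite subUset !sub1set iA jA cards2 ij => /(_ isT).
  by rewrite bigcup_setU !big_set1 !sN // sij setUid cards1.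
rewrite negb_forall_in => /exists_inP[i iA]; rewrite -ltnNge => /card_gt1P[a [b [aN bN ab]]].
pose del c j := if j == i then N j :\ c else N j.
have shrink c : c \in N i ->
    [forall X : {set I}, (X \subset A) ==> (#|X| <= #|\bigcup_(j in X) del c j|)] ->
    exists2 s : I -> K, {in A &, injective s} & forall i, i \in A -> s i \in N i.
  move=> cN ok; have [||s sinj sN] := IH (del c).
  - apply: leq_trans le_m.
    rewrite (bigD1 i) //= [X in _ < X](bigD1 i) //=.
    rewrite {1}/del eqxx [in X in _ < X](cardsD1 c) cN add1n ltnS leq_add2l.
    by apply: leq_sum => j /andP[_ /negPf ji]; rewrite /del ji.
  - by move=> X XA; have /implyP := forallP ok X; apply.
  exists s => // j jA; move: (sN j jA); rewrite /del.
  by case: eqP => // _; rewrite in_setD1 => /andP[].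
have [/(shrink a aN)//|] :=
  boolP [forall X : {set I}, (X \subset A) ==> (#|X| <= #|\bigcup_(j in X) del a j|)].
have [/(shrink b bN)//|] :=
  boolP [forall X : {set I}, (X \subset A) ==> (#|X| <= #|\bigcup_(j in X) del b j|)].
have viol c (X : {set I}) : ~~ ((X \subset A) ==> (#|X| <= #|\bigcup_(j in X) del c j|)) ->
    [/\ X \subset A, i \in X & #|\bigcup_(j in X) del c j| < #|X|].
  rewrite negb_imply -ltnNge => /andP[XA lt]; split=> //.
  apply: contraLR lt => iX; rewrite -leqNgt.
  rewrite (eq_bigr N) => [|j jX]; first exact: hallN.
  rewrite /del; case: eqP => // ji.
  by rewrite -ji jX in iX.
rewrite !negb_forall => /existsP[Y /viol[YA iY ltY]] /existsP[X /viol[XA iX ltX]].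
set U := \bigcup_(j in X) _ in ltX; set W := \bigcup_(j in Y) _ in ltY.
have capUW : \bigcup_(j in (X :&: Y) :\ i) N j \subset U :&: W.
  apply/bigcupsP => j; rewrite !inE => /and3P[ji jX jY].
  by rewrite subsetI; apply/andP; split;
     [rewrite /U (bigD1 j) | rewrite /W (bigD1 j)] => //=;
     rewrite {1}/del (negPf ji) subsetUl.
have cupUW : \bigcup_(j in X :|: Y) N j \subset U :|: W.
  have delS (Z : {set I}) c j x : j \in Z -> x \in N j -> (j == i -> x != c) ->
      x \in \bigcup_(j in Z) del c j.
    move=> jZ xj xc; apply/bigcupP; exists j; rewrite // /del.
    by case: (j == i) xc => // /(_ isT) xc; rewrite !inE xc.
  apply/subsetP => x /bigcupP[j jXY xj]; rewrite inE.
  have [ji|ji] := eqVneq j i.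
    have [xa|xa] := eqVneq x a.
      by rewrite orbC (delS Y b j) ?ji // -ji // xa.
    by rewrite (delS X a j) // ji.
  move: jXY; rewrite inE => /orP[jX|jY].
    by rewrite (delS X a j) // (negPf ji).
  by rewrite orbC (delS Y b j) // (negPf ji).
have := leq_trans (hallN (X :|: Y) _) (subset_leq_card cupUW).
rewrite subUset XA YA => /(_ isT).
have := leq_trans (hallN ((X :&: Y) :\ i) _) (subset_leq_card capUW).
rewrite (subset_trans (subsetDl _ _)) ?(subset_trans (subsetIl _ _)) // => /(_ isT).
have := cardsUI U W; have := cardsUI X Y; have := cardsD1 i (X :&: Y).
by rewrite inE iX iY /=; lia.
Qed.

(** * Barriers *)

Program Definition delG (V : finType) (G : sgraph V) (S : {set V}) : sgraph V :=
  @SGraph V [rel x y | [&& x \notin S, y \notin S & G x y]] _ _.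
Next Obligation. by move=> x y /=; rewrite adjC andbCA. Qed.
Next Obligation. by move=> x /=; rewrite adjxx !andbF. Qed.

Lemma delG_sub (V : finType) (G : sgraph V) S : subrel (delG G S) G.
Proof. by move=> x y /and3P[]. Qed.

Lemma matching_sub (V : finType) (F G : sgraph V) f :
  subrel F G -> matching F f -> matching G f.
Proof.
by move=> FG /matchingP[fI fF]; apply/matchingP; split=> // x /fF /FG.
Qed.

Lemma odd_unmatched (V : finType) (G : sgraph V) f :
  matching G f -> odd #|unmatched f| = odd #|V|.
Proof.
case/matchingP=> fI _; rewrite -cardsT.
rewrite -(odd_fixpoints fI (fun x _ => in_setT (f x))).
by congr (odd _); apply: eq_card => x; rewrite !inE.
Qed.

Lemma odd_defect (V : finType) (G : sgraph V) : odd (defect G) = odd #|V|.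
Proof.
have [f fmax] := exists_maximum G.
by rewrite -(card_maximum fmax) (odd_unmatched (maximum_matching fmax)).
Qed.

(** Take a largest S whose deletion costs a maximum matching |S| edges. If v could not be missed in
    G - S, deleting v as well would raise the defect, hence by parity raise it by
    two, and S would not be largest. The vertices of S are isolated in
    [delG G S], hence missable there. *)
Lemma exists_barrier (V : finType) (G : sgraph V) :
  exists S : {set V}, defect G + 2 * #|S| <= defect (delG G S) /\
    forall v, missable (delG G S) v.
Proof.
pose P (S : {set V}) := defect G + 2 * #|S| <= defect (delG G S).
have P0 : P set0.
  have [f fmax] := exists_maximum (delG G set0).
  rewrite /P cards0 addn0 -(card_maximum fmax) defect_le //.
  by apply: matching_sub (maximum_matching fmax); apply: delG_sub.
case: (arg_maxnP (fun S : {set V} => #|S|) P0) => S PS Smax.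
exists S; split=> // v.
have [vS|vS] := boolP (v \in S).
  have [f fmax] := exists_maximum (delG G S); exists f => //.
  have [_ fG] := matchingP _ _ (maximum_matching fmax).
  by apply/eqP; apply: contraT => /fG /and3P[]; rewrite vS.
have [/existsP[f /andP[fmax /eqP fv]]|] :=
  boolP [exists f, maximum (delG G S) f && (f v == v)]; first by exists f.
rewrite negb_exists => /forallP nmiss.
have : P (v |: S).
  have [f fmax] := exists_maximum (delG G (v |: S)).
  have fM : matching (delG G S) f.
    apply: matching_sub (maximum_matching fmax) => x y /and3P[].
    by rewrite /= !inE !negb_or => /andP[_ ->] /andP[_ ->].
  have fv : f v = v.
    have [_ fG] := matchingP _ _ (maximum_matching fmax).
    by apply/eqP; apply: contraT => /fG /and3P[]; rewrite !inE eqxx.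
  have := nmiss f; rewrite fv eqxx andbT /maximum fM /= => ndef.
  have := odd_unmatched fM; rewrite -(odd_defect (delG G S)).
  have := defect_le fM; move: PS; rewrite /P -(card_maximum fmax) cardsU1 vS.
  by move: ndef; lia.
by move/Smax; rewrite /= cardsU1 vS; lia.
Qed.

(** * Light components of a regular graph *)

Definition boundary (V : finType) (G : sgraph V) (Q : {set V}) : {set V * V} :=
  [set e | [&& e.1 \in Q, e.2 \notin Q & G e.1 e.2]].

Definition connected_in (V : finType) (G : sgraph V) (Q : {set V}) : Prop :=
  forall P : {set V}, P \subset Q -> P != set0 ->
    (forall x y, x \in P -> y \in Q -> G x y -> y \in P) -> P = Q.

(** The property of a component of G minus a set of vertices that exchanges rely
    on; in a k-regular graph it makes Q large ([light_card]). *)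
Definition light (V : finType) (G : sgraph V) (k : nat) (Q : {set V}) : Prop :=
  [/\ Q != set0, connected_in G Q & #|boundary G Q| < k].

(** Forgetting the edges at S uncovers at most two vertices for each vertex of S,
    which is exactly what the barrier inequality allows. *)
Lemma maximum_restrict (V : finType) (G : sgraph V) (S : {set V}) f :
  defect G + 2 * #|S| <= defect (delG G S) -> maximum G f ->
  maximum (delG G S) [ffun x => if (x \notin S) && (f x \notin S) then f x else x].
Proof.
move=> barS fmax; have [fI fG] := matchingP _ _ (maximum_matching fmax).
apply: maximumE.
  apply/matchingP; split=> x; rewrite !ffunE.
    case: (boolP ((x \notin S) && (f x \notin S))) => [/andP[xS fS]|/negPf E].
      by rewrite fI fS xS.
    by rewrite E.
  by case: ifP => [/andP[xS fS]|_]; rewrite ?eqxx // => /fG Gx; apply/and3P.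
apply: leq_trans barS; rewrite -(card_maximum fmax) mul2n -addnn addnA.
rewrite -[X in _ + X](card_imset _ (inv_inj fI)).
apply: leq_trans (_ : _ <= #|unmatched f :|: S :|: f @: S|) _; last first.
  apply: leq_trans (leq_card_setU _ _) _; rewrite leq_add2r.
  exact: (leq_card_setU _ _).
apply/subset_leq_card/subsetP => x; rewrite !inE ffunE.
case: (boolP (x \in S)) => [_|xS] /=; first by rewrite orbT.
case: (boolP (f x \in S)) => [fxS _|_ ->//].
by apply/orP; right; apply/imsetP; exists (f x); rewrite ?fI.
Qed.

Lemma connected_component (V : finType) (G F : sgraph V) q :
  subrel F G -> connected_in G [set x | connect F q x].
Proof.
move=> FG P /subsetP PQ /set0Pn[x0 x0P] closedP; apply/eqP; rewrite eqEsubset.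
apply/andP; split; first exact/subsetP.
have qx0 : connect F q x0 by have := PQ _ x0P; rewrite inE.
apply/subsetP => x; rewrite inE => qx.
have : connect F x0 x by apply: connect_trans qx; rewrite connectC.
case/connectP => p; elim: p x0 x0P qx0 => [|y p IH] x0 x0P qx0 /=; first by move=> _ ->.
case/andP=> Fx0y path_p last_p.
have qy : connect F q y := connect_trans qx0 (connect1 Fx0y).
by apply: (IH y) => //; apply: (closedP x0) => //; rewrite ?inE //; apply: FG.
Qed.

(** Delete a barrier S. Every maximum matching of the rest misses exactly one vertex
    of each component, and any vertex is missed by one of them. A maximum matching of G
    shows that any set X of components has at least |X| - defect G neighbours in
    S, and a set X of components that are not light has at least |X| neighbours in
    S, because it sends at least k |X| edges to S, whose vertices absorb at most
    k each. Hence Hall's theorem applies to the components, matched into S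
    together with defect G dummy vertices that are adjacent to the light
    components only. By counting, all of S and all dummies are used. The
    components matched to two of the dummies are Q1 and Q2: pairing each
    vertex of S with a neighbour in its component, and completing inside
    each component, gives maximum matchings that miss any chosen vertices
    of Q1 and Q2. *)
Lemma light_components (V : finType) (G : sgraph V) (k : nat) :
  0 < k -> (forall v, deg G v = k) -> 1 < defect G ->
  exists Q1 Q2 : {set V},
    [/\ light G k Q1, light G k Q2,
        forall x y, x \in Q1 -> y \in Q2 -> (x != y) && ~~ G x y
      & forall x y, x \in Q1 -> y \in Q2 -> comissable G x y].
Proof.
move=> k_gt0 regG defG.
have [S [barS miss]] := exists_barrier G.
have [M Mmax] := exists_maximum G.
have [MI MG] := matchingP _ _ (maximum_matching Mmax).
set F := delG G S in barS miss *.
have := maximum_restrict barS Mmax.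
set f := [ffun x => _] => fmax.
have fE x : x \notin S -> M x \notin S -> f x = M x by rewrite ffunE => -> ->.
have fS x : x \in S -> f x = x by rewrite ffunE => ->.
have connS x y : connect F x y -> x \in S -> x = y.
  case/connectP=> -[|z p] /=; first by move=> _ ->.
  by case/andP=> /and3P[/negPf->].
have connNS x y : connect F x y -> (x \in S) = (y \in S).
  by move=> xy; apply/idP/idP => h; [rewrite -(connS x y) | rewrite -(connS y x) // connectC].
have [rep repP] : exists rep : V -> V, forall x, connect F x (rep x) /\ f (rep x) = rep x.
  apply: (fin_all_exists (P := fun x q => connect F x q /\ f q = q)) => x.
  by have [q xq fq] := component_unmatched x miss fmax; exists q.
have repE x y : connect F x y -> f y = y -> rep x = y.
  move=> xy fy; have [xr fr] := repP x.
  have ry : connect F (rep x) y by apply: connect_trans xy; rewrite connectC.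
  by have [//|[]] := gallai miss ry; exists f.
have rep_connect x y : connect F x y -> rep x = rep y.
  move=> xy; have [yr fr] := repP y; apply: repE => //; exact: connect_trans xy yr.
pose I := unmatched f :\: S.
have IP q : reflect (q \notin S /\ f q = q) (q \in I).
  by rewrite !inE; apply: (iffP andP) => -[? /eqP ?].
have repI x : x \notin S -> rep x \in I.
  by move=> xS; have [xr fr] := repP x; apply/IP; rewrite -(connNS x).
have cardI : defect G + #|S| <= #|I|.
  have := cardsID S (unmatched f); rewrite -/I (card_maximum fmax).
  have := subset_leq_card (subsetIr (unmatched f) S); rewrite -/F; move: barS; lia.
pose comp q := [set x | connect F q x].
pose N q : {set V + 'I_(defect G)} := [set z | match z with
  | inl t => (t \in S) && [exists x in comp q, G x t]
  | inr _ => #|boundary G (comp q)| < k end].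
have hallN (X : {set V}) : X \subset I -> #|X| <= #|\bigcup_(q in X) N q|.
  move=> /subsetP XI.
  (* the neighbours in S of the components in X *)
  pose NS := [set t in S | [exists q in X, [exists x in comp q, G x t]]].
  have NSsub : (@inl _ _) @: NS \subset \bigcup_(q in X) N q.
    apply/subsetP => z /imsetP[t]; rewrite inE => /andP[tS /exists_inP[q qX ex]] ->.
    by apply/bigcupP; exists q; rewrite ?inE ?tS.
  have [/exists_inP[q0 q0X light0]|] := boolP [exists q in X, #|boundary G (comp q)| < k].
    have sub : (@inl _ _) @: NS :|: (@inr _ _) @: setT \subset \bigcup_(q in X) N q.
      rewrite subUset NSsub; apply/subsetP => z /imsetP[j _ ->].
      by apply/bigcupP; exists q0; rewrite ?inE.
    apply: leq_trans (subset_leq_card sub).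
    rewrite cardsU [X in _ - X](_ : _ = 0) ?subn0; last first.
      apply/eqP; rewrite cards_eq0; apply/eqP/setP => -[t|j]; rewrite !inE.
        by apply/negP => /andP[_ /imsetP[]].
      by apply/negP => /andP[/imsetP[]].
    rewrite !card_imset ?cardsT ?card_ord; try by move=> ? ? [].
    rewrite -[#|NS|](card_imset _ (inv_inj MI)) -(card_maximum Mmax).
    apply: leq_trans (leq_card_setU _ _).
    apply/subset_leq_card/subsetP => q qX.
    have [qS fq] := IP _ (XI q qX).
    have [Mq|Mq] := boolP (M q \in S); last first.
      by rewrite !inE -(fE q) // fq eqxx orbT.
    rewrite inE; apply/orP; left; apply/imsetP; exists (M q); rewrite ?MI //.
    rewrite inE Mq; apply/exists_inP; exists q => //; apply/exists_inP; exists q.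
      by rewrite inE connect0.
    by apply: MG; apply: contraNneq qS => <-.
  rewrite negb_exists_in => /forall_inP heavy.
  apply: leq_trans (subset_leq_card NSsub); rewrite card_imset; last by move=> ? ? [].
  rewrite -(leq_pmul2l k_gt0).
  pose E := [set e : V * V | [&& rep e.1 \in X, e.2 \in NS & G e.1 e.2]].
  apply: (@leq_trans #|E|).
    rewrite -[#|E|]sum1_card (partition_big (fun e => rep e.1) (mem X)) /=; last first.
      by move=> e; rewrite inE => /and3P[].
    rewrite mulnC -sum_nat_const; apply: leq_sum => q qX.
    rewrite sum1_card; have := heavy q qX; rewrite -leqNgt => /leq_trans; apply.
    have [qS fq] := IP _ (XI q qX).
    apply/subset_leq_card/subsetP => -[x t].
    rewrite !inE => /and3P[qx nqt Gxt].
    have {}qx : connect F q x by []. have {}nqt : ~~ connect F q t by [].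
    have {}Gxt : G x t by [].
    have rx : rep x = q by apply: repE; rewrite // connectC.
    have tS : t \in S.
      have xS : x \notin S by rewrite -(connNS q x).
      apply: contraNT nqt => tS; apply: connect_trans qx (connect1 _).
      by apply/and3P.
    have xtE : (x, t) \in E.
      rewrite !inE rx qX tS Gxt /= andbT; apply/exists_inP; exists q => //.
      by apply/exists_inP; exists x; rewrite // inE.
    by rewrite -[_ \in _]/((_ \in E) && _) xtE /= rx eqxx.
  rewrite -[#|E|]sum1_card (partition_big (fun e => e.2) (mem NS)) /=; last first.
    by move=> e; rewrite inE => /and3P[].
  rewrite mulnC -sum_nat_const; apply: leq_sum => t tNS.
  rewrite sum1_card -(regG t).
  rewrite /deg -[leqRHS](card_imset _ (f := fun w => (w, t))); last by move=> ? ? [].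
  apply/subset_leq_card/subsetP => -[x t'] /andP[].
  rewrite inE => /and3P[_ _ Gxt] /eqP E'; rewrite /= in E' Gxt; subst t'.
  by apply/imsetP; exists x; rewrite // inE adjC.
have v0 : V.
  have : 0 < #|I| by apply: leq_trans cardI; rewrite addn_gt0 (ltnW defG).
  by move=> /card_gt0P/sigW[v].
(* components are represented by the vertices of I, one in each; inr is the dummies *)
have [s sinj sN] := hall (inl v0) hallN.
(* by counting, the Hall matching is onto *)
have s_onto z : (if z is inl t then t \in S else true) -> exists2 q, q \in I & s q = z.
  pose K : {set V + 'I_(defect G)} := (@inl _ _) @: S :|: (@inr _ _) @: setT.
  have KE y : (y \in K) = (if y is inl t then t \in S else true).
    rewrite inE; case: y => [t|j].
      rewrite mem_imset; last by move=> ? ? [].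
      by case: (t \in S) => //=; apply/negP => /imsetP[].
    by apply/orP; right; apply/imsetP; exists j.
  have sK : s @: I = K.
    apply/eqP; rewrite eqEcard; apply/andP; split.
      apply/subsetP => _ /imsetP[q /sN sq ->]; rewrite KE.
      by move: sq; rewrite inE; case: (s q) => // t /andP[].
    rewrite card_in_imset // (leq_trans _ cardI) // /K addnC.
    apply: leq_trans (leq_card_setU _ _) _.
    by rewrite !card_imset ?cardsT ?card_ord // => ? ? [].
  by rewrite -KE -sK => /imsetP[q qI ->]; exists q.
have [q1 q1I s1] := s_onto (inr (Ordinal (ltnW defG))) isT.
have [q2 q2I s2] := s_onto (inr (Ordinal defG)) isT.
have q12 : q1 != q2.
  by apply/eqP => E; move: s1; rewrite E s2 => -[].
have lightP q j : q \in I -> s q = inr j -> light G k (comp q).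
  move=> qI sq; split.
  - by apply/set0Pn; exists q; rewrite inE connect0.
  - by apply: connected_component; apply: delG_sub.
  - by have := sN q qI; rewrite inE sq.
have compC x y : x \in comp q1 -> y \in comp q2 -> ~~ connect F x y.
  rewrite !inE => q1x q2y; apply: contra q12 => xy; apply/eqP.
  have [[_ f1] [_ f2]] := (IP _ q1I, IP _ q2I).
  have r1 : rep x = q1 by apply: repE; rewrite // connectC.
  have r2 : rep y = q2 by apply: repE; rewrite // connectC.
  by rewrite -r1 -r2; apply: rep_connect.
exists (comp q1), (comp q2); split; [exact: lightP s1 | exact: lightP s2 | |] => x y q1x q2y.
  have xy : ~~ connect F x y by apply: compC.
  have [q1S q2S] : q1 \notin S /\ q2 \notin S by split; [case: (IP _ q1I) | case: (IP _ q2I)].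
  have xS : x \notin S by rewrite -(connNS q1) //; move: q1x; rewrite inE.
  have yS : y \notin S by rewrite -(connNS q2) //; move: q2y; rewrite inE.
  apply/andP; split; first by apply: contraNneq xy => ->.
  by apply: contra xy => Gxy; apply: connect1; apply/and3P.
(* the vertex of each component that is left out of the matching inside it *)
pose p q := if q \in S then q else if q == q1 then x else if q == q2 then y else
  match s q with inl t => odflt q [pick w in comp q | G w t] | inr _ => q end.
have p_conn q : connect F q (p q).
  rewrite /p; case: ifP => // _.
  case: eqVneq => [->|_]; first by move: q1x; rewrite inE.
  case: eqVneq => [->|_]; first by move: q2y; rewrite inE.
  case: (s q) => [t|_] //; case: pickP => [w|_] //=.
  by rewrite inE => /andP[].
have [g gP] : exists g : V -> {ffun V -> V}, forall v, maximum F (g v) /\ g v v = v.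
  apply: (fin_all_exists (P := fun v h => maximum F h /\ h v = v)) => v.
  by have [h hmax hv] := miss v; exists h.
have [sinv sinvP] : exists sinv : V -> V,
    forall t, t \in S -> sinv t \in I /\ s (sinv t) = inl t.
  apply: (fin_all_exists (P := fun t q => t \in S -> q \in I /\ s q = inl t)) => t.
  have [tS|tS] := boolP (t \in S); last by exists v0.
  by have [q qI sq] := s_onto (inl t) tS; exists q.
(* inside each component, a maximum matching that misses the chosen vertex *)
pose m0 v := g (p (rep v)) v.
have m0_conn v : connect F v (m0 v).
  by apply: connect_matching; apply: maximum_matching; case: (gP (p (rep v))).
have m0I : involutive m0.
  move=> v; rewrite {1}/m0 -(rep_connect v) // /m0.
  by have [/maximum_matching/matchingP[gI _] _] := gP (p (rep v)); rewrite gI.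
have m0F v : m0 v != v -> F v (m0 v).
  by have [/maximum_matching/matchingP[_ gF] _] := gP (p (rep v)) => /gF.
have rep_p v : rep (p (rep v)) = rep v.
  have [vr fr] := repP v; apply: repE => //.
  by rewrite connectC; apply: p_conn.
have m0p v : m0 v = v -> v = p (rep v).
  rewrite /m0 => m0v; have [gmax gp] := gP (p (rep v)).
  have vp : connect F v (p (rep v)).
    by have [vr _] := repP v; apply: connect_trans vr (p_conn _).
  by have [//|[]] := gallai miss vp; exists (g (p (rep v))).
have pI q : q \in I -> [/\ p q \notin S, rep (p q) = q & m0 (p q) = p q].
  move=> /IP[qS fq]; have pq : rep (p q) = q by apply: repE => //; rewrite connectC.
  by split; rewrite -?(connNS q (p q)) // /m0 pq; case: (gP (p q)).
have pG q t : q \in I -> s q = inl t -> t \in S /\ G (p q) t.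
  move=> qI sq; have [qS fq] := IP _ qI.
  have := sN q qI; rewrite inE sq => /andP[tS /exists_inP[w qw Gwt]]; split=> //.
  rewrite /p (negPf qS); case: eqVneq => [E|_]; first by rewrite E s1 in sq.
  case: eqVneq => [E|_]; first by rewrite E s2 in sq.
  rewrite sq; case: pickP => [w' /andP[]//|/(_ w)].
  by rewrite qw Gwt.
(* the chosen vertices are joined to S as the Hall matching tells *)
pose h := [ffun v => if v \in S then p (sinv v) else if m0 v == v then
  match s (rep v) with inl t => t | inr _ => v end else m0 v].
have hS t : t \in S -> h t = p (sinv t) by move=> tS; rewrite ffunE tS.
have hm v : v \notin S -> m0 v != v -> h v = m0 v.
  by move=> vS m0v; rewrite ffunE (negPf vS) (negPf m0v).
have hp q : q \in I -> h (p q) = if s q is inl t then t else p q.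
  by move=> qI; have [pS pr pm] := pI q qI; rewrite ffunE (negPf pS) pm eqxx pr.
have hM : matching G h.
  apply/matchingP; split=> v.
    have [vS|vS] := boolP (v \in S).
      by have [vI sv] := sinvP v vS; rewrite (hS v vS) hp // sv.
    have [m0v|m0v] := eqVneq (m0 v) v.
      have rI := repI v vS; rewrite (m0p v m0v) !hp //.
      case E: (s (rep v)) => [t|j]; last by rewrite hp // E.
      have [tS _] := pG _ _ rI E; rewrite hS //.
      have [tI st] := sinvP t tS; congr p; apply: sinj => //.
      by rewrite st E.
    by rewrite (hm v) // hm ?m0I // -?(connNS v (m0 v)) // eq_sym.
  have [vS _|vS] := boolP (v \in S).
    have [vI sv] := sinvP v vS; rewrite hS // adjC.
    by have [] := pG _ _ vI sv.
  have [m0v|m0v] := eqVneq (m0 v) v.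
    have rI := repI v vS; rewrite (m0p v m0v) hp //.
    case E: (s (rep v)) => [t|j]; last by rewrite eqxx.
    by have [] := pG _ _ rI E.
  by rewrite hm // => _; apply: delG_sub (m0F v m0v).
have h_unmatched v : h v = v ->
    [/\ rep v \in I, v = p (rep v) & exists j, s (rep v) = inr j].
  move=> hv.
  have [vS|vS] := boolP (v \in S).
    by have [vI _] := sinvP v vS; have [] := pI _ vI; rewrite -hS // hv vS.
  have rI := repI v vS; have m0v : m0 v = v.
    by apply/eqP; apply: contraT => m0v; move: (m0v); rewrite -(hm v vS m0v) hv eqxx.
  split; [by [] | exact: m0p |].
  case E: (s (rep v)) => [t|j]; last by exists j.
  have [tS _] := pG _ _ rI E.
  by move: vS; rewrite -hv (m0p v m0v) hp // E tS.
exists h.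
  apply: maximumE => //.
  rewrite -(card_in_imset (f := fun v => s (rep v))) /=.
    apply: (@leq_trans #|(@inr V 'I_(defect G)) @: setT|); last first.
      by rewrite card_imset ?cardsT ?card_ord // => ? ? [].
    apply/subset_leq_card/subsetP => z /imsetP[v].
    rewrite inE => /eqP/h_unmatched[_ _ [j sj]] ->.
    by apply/imsetP; exists j; rewrite // inE.
  move=> v w; rewrite !inE => /eqP/h_unmatched[vI vp _] /eqP/h_unmatched[wI wp _] E.
  by rewrite vp wp (sinj _ _ vI wI E).
have p1 : p q1 = x by rewrite /p eqxx; case: (IP _ q1I) => /negPf->.
have p2 : p q2 = y.
  by rewrite /p eqxx eq_sym (negPf q12); case: (IP _ q2I) => /negPf->.
by split; [rewrite -p1 hp // s1 | rewrite -p2 hp // s2].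
Qed.

(** * Exchanges between two light components *)

Lemma card_boundary (V : finType) (G : sgraph V) (Q : {set V}) :
  #|boundary G Q| = \sum_(x in Q) #|[set w | G x w] :\: Q|.
Proof.
rewrite -sum1_card (partition_big (fun e => e.1) (mem Q)) /=; last first.
  by move=> e; rewrite inE => /and3P[].
apply: eq_bigr => x xQ; rewrite sum1_card.
have pair_inj : injective (fun w : V => (x, w)) by move=> ? ? [].
rewrite -[RHS](card_imset _ pair_inj); apply: eq_card => -[x' w].
apply/andP/imsetP => [[]|[w' + [-> ->]]].
  rewrite inE => /and3P[/= _ wQ Gxw] /eqP /= E; subst x'.
  by exists w; rewrite // !inE wQ.
by rewrite !inE => /andP[wQ Gxw]; rewrite xQ wQ.
Qed.

(** A vertex of Q has at most |Q| - 1 neighbours in Q, so |Q| <= k would give at least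
    |Q| (k - |Q| + 1) >= k boundary edges. *)
Lemma light_card (V : finType) (G : sgraph V) (k : nat) (Q : {set V}) :
  (forall v, deg G v = k) -> light G k Q -> k < #|Q|.
Proof.
move=> regG [Q0 _ lightQ]; rewrite ltnNge; apply/negP => leQ.
have : #|Q| * (k - #|Q|.-1) <= #|boundary G Q|.
  rewrite card_boundary -sum_nat_const; apply: leq_sum => x xQ.
  have := cardsID Q [set w | G x w]; rewrite -/(deg G x) regG.
  have : #|[set w | G x w] :&: Q| <= #|Q :\ x|.
    apply/subset_leq_card/subsetP => w; rewrite !inE => /andP[Gxw ->].
    by rewrite eq_sym (adj_neq Gxw).
  by have := cardsD1 x Q; rewrite xQ; lia.
move: Q0; rewrite -card_gt0; move: leQ lightQ; nia.
Qed.

(** There are fewer boundary edges than vertices. *)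
Lemma light_inner (V : finType) (G : sgraph V) (k : nat) (Q : {set V}) :
  (forall v, deg G v = k) -> light G k Q ->
  exists2 y, y \in Q & [set w | G y w] \subset Q.
Proof.
move=> regG lQ; have ltQ := light_card regG lQ; have [_ _ lightQ] := lQ.
apply/exists_inP; apply: contraT; rewrite negb_exists_in => /forall_inP all_out.
have : #|Q| <= #|boundary G Q|.
  rewrite card_boundary -sum1_card; apply: leq_sum => x xQ.
  rewrite card_gt0 setD_eq0; exact: all_out.
by lia.
Qed.

Lemma light_neighbour (V : finType) (G : sgraph V) (k : nat) (Q : {set V}) x :
  0 < k -> (forall v, deg G v = k) -> light G k Q -> x \in Q ->
  exists2 y, y \in Q & G x y.
Proof.
move=> k_gt0 regG lQ xQ; have [_ conn _] := lQ; have ltQ := light_card regG lQ.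
apply/exists_inP; apply: contraT; rewrite negb_exists_in => /forall_inP iso.
have Q1 : [set x] = Q.
  apply: conn; rewrite ?sub1set //; first by apply/set0Pn; exists x; rewrite set11.
  by move=> z y; rewrite inE => /eqP-> yQ Gxy; have := iso y yQ; rewrite Gxy.
by move: ltQ; rewrite -Q1 cards1; lia.
Qed.

(** Take y1 in Q2 with no neighbour outside Q2. If no exchange is possible and x1 in
    Q1 may be joined to y1, then every neighbour x2 of x1 in Q1 is joined by C to
    all k neighbours of y1; as C has degree at most k, these are all the
    C-neighbours of x2, so x2 may be joined to y1 as well. Some x1 may be joined
    to y1, because |Q1| > k, so by connectedness every vertex of Q1 may. But then a
    neighbour y2 of y1 is a C-neighbour of all of Q1, which has more than k
    vertices. *)
Lemma exists_exchange (V : finType) (C G : sgraph V) (k : nat) (Q1 Q2 : {set V}) :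
  0 < k -> (forall v, deg G v = k) -> (forall v, deg C v <= k) ->
  light G k Q1 -> light G k Q2 ->
  exists x1 x2 y1 y2,
    [/\ x1 \in Q1 /\ x2 \in Q1, y1 \in Q2 /\ y2 \in Q2,
        G x1 x2, G y1 y2 & ~~ C x1 y1 /\ ~~ C x2 y2].
Proof.
move=> k_gt0 regG degC l1 l2.
have lt1 := light_card regG l1; have [_ conn1 _] := l1.
have [y1 y1Q2 /subsetP inner] := light_inner regG l2.
have [/existsP[x1 /existsP[x2 /existsP[y2 /and4P[/andP[h1 h2] h3 h4 /and3P[h5 h6 h7]]]]]|none] :=
  boolP [exists x1, exists x2, exists y2, [&& (x1 \in Q1) && (x2 \in Q1), y2 \in Q2,
    G x1 x2 & [&& G y1 y2, ~~ C x1 y1 & ~~ C x2 y2]]].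
  by exists x1, x2, y1, y2.
have blocked x1 x2 y2 : x1 \in Q1 -> x2 \in Q1 -> G x1 x2 -> G y1 y2 ->
    ~~ C x1 y1 -> C x2 y2.
  move=> x1Q x2Q Gx Gy nC; apply: contraNT none => nC2.
  apply/existsP; exists x1; apply/existsP; exists x2; apply/existsP; exists y2.
  by rewrite x1Q x2Q Gx Gy nC nC2 inner // inE.
(* the vertices of Q1 that may be joined to y1 *)
pose P := [set x in Q1 | ~~ C x y1].
have PQ : P = Q1.
  apply: conn1.
  - by apply/subsetP => x; rewrite inE => /andP[].
  - apply: contraTneq lt1 => P0; rewrite -leqNgt; apply: leq_trans (degC y1).
    apply/subset_leq_card/subsetP => x xQ1; rewrite inE adjC.
    apply: contraT => nC; suff : x \in P by rewrite P0 inE.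
    by rewrite inE xQ1.
  - move=> x x2; rewrite inE => /andP[xQ nC] x2Q Gx; rewrite inE x2Q.
    have sub : [set w | G y1 w] \subset [set w | C x2 w].
      by apply/subsetP => w; rewrite !inE => Gyw; apply: (blocked x).
    have /eqP E : [set w | G y1 w] == [set w | C x2 w].
      by rewrite eqEcard sub -/(deg G y1) regG -/(deg C x2) degC.
    apply/negP => Cxy; have : y1 \in [set w | G y1 w] by rewrite E inE.
    by rewrite inE adjxx.
have [y2 Gy12] : exists y2, G y1 y2.
  have : 0 < deg G y1 by rewrite regG.
  by rewrite card_gt0 => /set0Pn[y2]; rewrite inE; exists y2.
have : #|Q1| <= deg C y2.
  apply/subset_leq_card/subsetP => x2 x2Q; rewrite inE adjC.
  have [x xQ Gx] := light_neighbour k_gt0 regG l1 x2Q.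
  apply: (blocked x) => //; first by rewrite adjC.
  by move: xQ; rewrite -PQ inE => /andP[].
by have := degC y2; lia.
Qed.

(** A maximum matching that misses x1 and y1 survives the exchange, which
    removes only edges at x1 or y1, and the new edge x1 y1 extends it. *)
Lemma reduce_defect (V : finType) (C G : sgraph V) (k : nat) :
  0 < k -> (forall v, deg G v = k) -> (forall v, deg C v <= k) ->
  edge_disjoint C G -> 1 < defect G ->
  exists H : sgraph V, [/\ forall v, deg H v = k, edge_disjoint C H
    & defect H < defect G].
Proof.
move=> k_gt0 regG degC CG defG.
have [Q1 [Q2 [l1 l2 apart missed]]] := light_components k_gt0 regG defG.
have [x1 [x2 [y1 [y2 [[x1Q x2Q] [y1Q y2Q] Gx Gy [nC1 nC2]]]]]] :=
  exists_exchange k_gt0 regG degC l1 l2.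
have /andP[ne1 nG1] := apart _ _ x1Q y1Q.
have /andP[ne2 nG2] := apart _ _ x2Q y2Q.
exists (swapG G x1 x2 y1 y2); split.
- by move=> v; rewrite deg_swap.
- move=> v w; apply/negP => /andP[Cvw] /orP[/andP[Gvw _]|].
    by have := CG v w; rewrite Cvw Gvw.
  have nC a b : a != b -> ~~ C a b -> ~~ edgeG a b v w.
    move=> ab nCab; apply/negP => E.
    have := @edge_sub V (complG C) a b _ v w E; rewrite /= ab nCab Cvw andbF.
    by move/(_ isT).
  by case/orP; apply/negP; apply: nC.
have [f fmax [fx fy]] := missed _ _ x1Q y1Q.
have [fI fG] := matchingP _ _ (maximum_matching fmax).
have fM : matching (swapG G x1 x2 y1 y2) f.
  apply/matchingP; split=> // v fv; apply/orP; left; apply/andP; split; first exact: fG.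
  have fixed a b : f a = a -> a != b -> ~~ edgeG a b v (f v).
    move=> fa ab; rewrite edgeGE //; apply: contra fv.
    by case/orP=> /andP[/eqP v1 /eqP v2]; [rewrite v1 fa | rewrite -{2}(fI v) v2 fa].
  by rewrite negb_or !fixed ?(adj_neq Gx) ?(adj_neq Gy).
have Hxy : swapG G x1 x2 y1 y2 x1 y1.
  apply/orP; right; apply/orP; left; by rewrite edgeGE // !eqxx.
have [g gM lt] := matching_add fM fx fy Hxy.
by rewrite -(card_maximum fmax); apply: leq_ltn_trans lt; apply: defect_le.
Qed.

Lemma perfect_matching_factor (V : finType) (G : sgraph V) :
  defect G = 0 -> exists F, factor 1 G F.
Proof.
move=> def0; have [f fmax] := exists_maximum G.
have [fI fG] := matchingP _ _ (maximum_matching fmax).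
have fv v : f v != v.
  have := card_maximum fmax; rewrite def0 => /eqP; rewrite cards_eq0 => /eqP/setP/(_ v).
  by rewrite !inE => ->.
have symF : symmetric (fun x y => f x == y).
  by move=> x y; apply/eqP/eqP => <-; rewrite fI.
have irrF : irreflexive (fun x y => f x == y) by move=> x; apply: negPf.
exists (SGraph symF irrF); split=> [x y /= /eqP<-|v]; first exact: fG.
by rewrite /deg -[RHS](cards1 (f v)); apply: eq_card => w; rewrite !inE eq_sym.
Qed.

(** * Edge-disjoint 1-factors *)

Lemma regular_1factor (V : finType) (C G : sgraph V) (k : nat) :
  ~~ odd #|V| -> 0 < k -> (forall v, deg G v = k) -> (forall v, deg C v <= k) ->
  edge_disjoint C G ->
  exists H F : sgraph V, [/\ forall v, deg H v = k, edge_disjoint C H & factor 1 H F].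
Proof.
move=> evenV k_gt0 + degC; have [m] := ubnP (defect G).
elim: m G => // m IH G; rewrite ltnS => le_m regG CG.
have [/eqP def0|def_pos] := posnP (defect G).
  by have [F GF] := perfect_matching_factor (eqP def0); exists G, F.
have def2 : 1 < defect G by move: evenV def_pos; rewrite -(odd_defect G); lia.
have [H [regH CH lt]] := reduce_defect k_gt0 regG degC CG def2.
by apply: (IH H) => //; apply: leq_trans le_m.
Qed.

Lemma edge_disjointC (V : finType) (G F : sgraph V) : edge_disjoint G F -> edge_disjoint F G.
Proof. by move=> GF v w; rewrite andbC. Qed.

(** A 1-factor F that has been found is moved from the regular graph into the
    forbidden graph C: the degree of the former drops by one and that of the
    latter rises by one, which costs two units of the slack k - deg C. *)
Lemma regular_1factors (V : finType) (v0 : V) (r : nat) (C G : sgraph V) (k : nat) :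
  ~~ odd #|V| -> 0 < k -> (forall v, deg G v = k) -> (forall v, deg C v + 2 * r <= k) ->
  edge_disjoint C G ->
  exists H : sgraph V, [/\ forall v, deg H v = k, edge_disjoint C H
    & has_edge_disjoint_1factors r.+1 H].
Proof.
move=> evenV; elim: r C G k => [|r IH] C G k k_gt0 regG degC CG.
  have [|H [F [regH CH HF]]] := regular_1factor evenV k_gt0 regG _ CG.
    by move=> v; have := degC v; lia.
  exists H; split=> //; exists (fun _ => F); split=> // i j.
  by rewrite !ord1 eqxx.
have [|H [F [regH CH [FH degF]]]] := regular_1factor evenV k_gt0 regG _ CG.
  by move=> v; have := degC v; lia.
have CF : edge_disjoint C F.
  by move=> v w; apply: contra (CH v w) => /andP[-> /FH ->].
have [||||H' [regH' CFH' [M [MH' Mdisj]]]] := IH (unionG C F) (diffG H F) k.-1.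
- by have := degC v0; lia.
- by move=> v; have := deg_diff v FH; rewrite degF regH; lia.
- by move=> v; rewrite deg_union // degF; have := degC v; lia.
- move=> v w; apply/negP => /andP[/orP[] /= h /andP[Hvw nF]]; last by rewrite h in nF.
  by have := CH v w; rewrite h Hvw.
have FH' : edge_disjoint F H'.
  by move=> v w; apply: contra (CFH' v w) => /andP[h ->]; rewrite /= h orbT.
exists (unionG F H'); split.
- by move=> v; rewrite deg_union // degF regH'; have := degC v; lia.
- move=> v w; apply/negP => /andP[Cvw /orP[Fvw|H'vw]].
    by have := CF v w; rewrite Cvw Fvw.
  by have := CFH' v w; rewrite /= Cvw H'vw.
exists (fun i => if unlift ord0 i is Some j then M j else F); split=> [i|i j].
  case: unliftP => [j _|_]; last by split=> // x y; rewrite /= => ->.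
  have [MjH' degM] := MH' j; split=> // x y /MjH' /= ->; exact: orbT.
have FM l : edge_disjoint F (M l).
  have [MlH' _] := MH' l.
  by move=> v w; apply: contra (FH' v w) => /andP[-> /MlH' ->].
case: unliftP => [i' ->|->]; case: unliftP => [j' ->|->] //.
- by rewrite (inj_eq lift_inj) => /Mdisj.
- by move=> _; apply: edge_disjointC.
Qed.

(** The hypotheses other than the degree bound on A are symmetric in A and B, so
    this serves both alternatives of the theorem. *)
Lemma packing_1factors (V : finType) (v0 : V) (k r : nat) (A B : sgraph V) :
  ~~ odd #|V| -> 0 < k -> (forall v, deg A v + deg B v + k + 1 = #|V|) ->
  (forall v, deg A v + 2 * r <= k) ->
  exists A' H : sgraph V,
    [/\ forall v, deg A' v = deg A v, forall v, deg H v = k, edge_disjoint A' H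
      & has_edge_disjoint_1factors r.+1 H].
Proof.
move=> evenV k_gt0 sum_deg degA.
have [A' [B' [dA dB AB]]] := kundu_packing sum_deg.
pose H0 := complG (unionG A' B').
have regH0 v : deg H0 v = k.
  have := deg_compl (unionG A' B') v; rewrite -/H0 deg_union // dA dB.
  by have := sum_deg v; lia.
have AH0 : edge_disjoint A' H0.
  by move=> v w; rewrite /=; case: (A' v w); rewrite ?andbF.
have [|H [regH AH H1]] := regular_1factors (r := r) v0 evenV k_gt0 regH0 _ AH0.
  by move=> v; rewrite dA.
by exists A', H.
Qed.

Local Open Scope ring_scope.

Theorem theorem8 (n k r : nat) (d : n.-tuple int)
  (n_gt0 : (0 < n)%N) (n_even : ~~ odd n) (k_ge1 : (1 <= k)%N)
  (d_noninc : sorted (fun x y : int => y <= x) d)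
  (d_graphic : graphic d)
  (Dkd_graphic : graphic (D_ k d))
  (hk : (d`_0)%:~R / 2 + r%:R <= k%:R :> rat \/
        n%:Z - 1 - d`_n.-1 + 2 * r%:Z <= k%:Z) :
  exists G H : sgraph 'I_n,
    [/\ realization d G, factor k G H & has_edge_disjoint_1factors r.+1 H].
Proof.
have [A realA] := Dkd_graphic; have [G0 realG0] := d_graphic.
pose B := complG G0.
have dA i : (deg A i)%:Z + k%:Z = tnth d i by rewrite realA tnth_mktuple subrK.
have dB i : (deg B i)%:Z + tnth d i = n%:Z - 1.
  by have := deg_compl G0 i; rewrite -realG0 card_ord -/B /reverse_coercion; lia.
have sum_deg i : (deg A i + deg B i + k + 1)%N = #|'I_n|.
  by have := dA i; have := dB i; rewrite card_ord /reverse_coercion; lia.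
have evenV : ~~ odd #|'I_n| by rewrite card_ord.
have v0 : 'I_n := Ordinal n_gt0.
have d_ge (i j : nat) : (i <= j)%N -> (j < n)%N -> d`_j <= d`_i.
  move=> ij jn; have tr : transitive (fun x y : int => y <= x).
    by move=> x y z yx zy; apply: le_trans zy yx.
  have := sorted_leq_nth tr (@lexx _ _) 0 d_noninc; apply=> //;
    by rewrite inE size_tuple // (leq_ltn_trans ij).
have dE (i : 'I_n) : tnth d i = d`_i by rewrite (tnth_nth 0).
case: hk => hk.
  have d0 : d`_0 + 2 * r%:Z <= 2 * k%:Z.
    by rewrite -(ler_int rat) !rmorphD /= !rmorphM /=; move: hk; lra.
  have degA i : (deg A i + 2 * r <= k)%N.
    have := dA i; have := d_ge 0%N i isT (ltn_ord i); rewrite dE.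
    by rewrite /reverse_coercion; move: d0; lia.
  have [A' [H [dA' regH AH H1]]] := packing_1factors v0 evenV k_ge1 sum_deg degA.
  exists (unionG A' H), H; split=> //.
    by move=> i; rewrite deg_union // dA' regH PoszD dA.
  by split=> // x y Hxy; rewrite /= Hxy orbT.
have degB i : (deg B i + 2 * r <= k)%N.
  have in1 : (i <= n.-1)%N by rewrite -ltnS prednK // ltn_ord.
  have := dB i; have := d_ge i n.-1 in1; rewrite prednK // leqnn dE => /(_ isT).
  by rewrite /reverse_coercion; move: hk; lia.
have sum_degC i : (deg B i + deg A i + k + 1)%N = #|'I_n|.
  by rewrite -(sum_deg i) (addnC (deg B i)).
have [B' [H [dB' regH BH H1]]] := packing_1factors v0 evenV k_ge1 sum_degC degB.
exists (complG B'), H; split=> //.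
  move=> i; have := deg_compl B' i; have := dB i.
  by rewrite dB' card_ord /reverse_coercion; lia.
split=> // x y Hxy; rewrite /= (adj_neq Hxy) /=.
by apply: contraTN Hxy => Bxy; have := BH x y; rewrite Bxy.
Qed.
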